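(* Let $a,b,c,d\in\mathbb{R}$ and consider the quartic polynomial $x^4+ax^3+bx^2+cx+d$. With the notation $C_0,C_1,C_2,\Delta(D),d_0,d_1,d_2,d_3,d^\dagger,\widetilde d$ defined in the context, the real roots of the quartic are as follows. Case $b>\frac38a^2$: (i) $c\neq C_0$, $d>d_0$: no real roots. (ii) $c\neq C_0$, $d=d_0$: two equal real roots. (iii) $c\neq C_0$, $d<d_0$: two distinct real roots. (iv) $c=C_0$, $d>\widetilde d$: no real roots (if moreover $d=d^\dagger$, there are two double complex roots). (v) $c=C_0$, $d=\widetilde d$: two equal real roots. (vi) $c=C_0$, $d<\widetilde d$: two distinct real roots. Case $b=\frac38a^2$ (so that $C_0=a^3/16$): (vii) $c\neq C_0$, $d>d_0$: no real roots. (viii) $c\neq C_0$, $d=d_0$: two equal real roots. (ix) $c\neq C_0$, $d<d_0$: two distinct real roots. (x) $c=C_0$, $d>d_0=a^4/256$: no real roots. (xi) $c=C_0$, $d=d_0=a^4/256$: four equal real roots $-a/4$. (xii) $c=C_0$, $d<d_0=a^4/256$: two distinct real roots. Case $b<\frac38a^2$, $C_2<c<C_1$, $c\neq C_0$: (xiii) $d>d_1$: no real roots. (xiv) $d=d_1$: two equal real roots. (xv) $d_2<d<d_1$: two distinct real roots. (xvi) $d=d_2$: four real roots, two of which (the two largest or the two smallest) are equal. (xvii) $d_3<d<d_2$: four distinct real roots. (xviii) $d=d_3$: four real roots, the middle two of which are equal. (xix) $d<d_3$: two distinct real roots. Case $b<\frac38a^2$, $c\in\{C_1,C_2\}$: (xx)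 $d>\widetilde d$: no real roots. (xxi) $d=\widetilde d$: two equal real roots. (xxii) $d^\dagger<d<\widetilde d$: two distinct real roots. (xxiii) $d=d^\dagger$: four real roots, three of which are equal. (xxiv) $d<d^\dagger$: two distinct real roots. Case $b<\frac38a^2$, $c=C_0$: (xxv) $d>d^\dagger$: no real roots. (xxvi) $d=d^\dagger$: two pairs of equal real roots. (xxvii) $\widetilde d<d<d^\dagger$: four distinct real roots. (xxviii) $d=\widetilde d$: four real roots, the middle two of which are equal. (xxix) $d<\widetilde d$: two distinct real roots. Case $b<\frac38a^2$, $c\notin[C_2,C_1]$: (xxx) $d>d_0$: no real roots. (xxxi) $d=d_0$: two equal real roots. (xxxii) $d<d_0$: two distinct real roots.
   Context: Roots are counted with multiplicity. ''No real roots'' means all four roots are non-real; ''two equal real roots'' means exactly one real root, of multiplicity two, together with a pair of non-real complex-conjugate roots; ''two distinct real roots'' means exactly two simple real roots together with a pair of non-real complex-conjugate roots; ''two pairs of equal real roots'' means two distinct real roots, each of multiplicity two; ''four real roots, two (respectively three) of which are equal'' means one real root of multiplicity two (respectively three), the remaining real roots being simple. Put $C_0=-\frac18a^3+\frac12ab$ and, when $3a^2-8b\ge0$, $C_{1}=C_0+\frac{\sqrt3}{72}\sqrt{(3a^2-8b)^3}$, $C_2=C_0-\frac{\sqrt3}{72}\sqrt{(3a^2-8b)^3}$. For fixed $a,b,c$ let $\Delta(D)$ be the discriminant of $x^4+ax^3+bx^2+cx+D$, regarded as a cubic polynomial in $D$: $$\Delta(D)=256D^3+(-27a^4+144a^2b-192ac-128b^2)D^2+2(9a^3bc-2a^2b^3-3a^2c^2-40ab^2c+8b^4+72bc^2)D-4a^3c^3+a^2b^2c^2+18abc^3-4b^3c^2-27c^4.$$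 Notation for the roots of $\Delta(D)$: - If $b\ge\frac38a^2$ and $c\ne C_0$, or if $b<\frac38a^2$ and $c\notin[C_2,C_1]$, then $\Delta(D)$ has exactly one real root, denoted $d_0$. - If $b=\frac38a^2$ and $c=C_0$, then $\Delta(D)$ has a triple root, also denoted $d_0$. - If $b<\frac38a^2$, $C_2<c<C_1$ and $c\neq C_0$, then $\Delta(D)$ has three distinct real roots, denoted $d_1>d_2>d_3$. - If $b\neq\frac38a^2$ and $c=C_0$, or if $b<\frac38a^2$ and $c\in\{C_1,C_2\}$, then $\Delta(D)$ has a double real root, denoted $d^\dagger$, and a single (simple) real root, denoted $\widetilde d$. *)

(* Defs.v *)
(* The real numbers are an arbitrary [R : realType], the complex numbers are
   [R[i]]. *)
From HB Require Import structures.
From mathcomp Require Import all_boot all_order all_algebra.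
From mathcomp Require Import complex ring reals.

Set Implicit Arguments.
Unset Strict Implicit.
Unset Printing Implicit Defensive.

Import Order.TTheory GRing.Theory Num.Theory.
Local Open Scope ring_scope.
Local Open Scope complex_scope.

Definition quartic (R : comNzRingType) (a b c d : R) : {poly R} :=
  'X^4 + a *: 'X^3 + b *: 'X^2 + c *: 'X + d%:P.

(* Discriminant of [quartic a b c D], as a polynomial in [D]; see
   [horner_Delta] below. *)
Definition Delta (R : comNzRingType) (a b c : R) : {poly R} :=
  256 *: 'X^3
  + (- (27 * a ^+ 4) + 144 * a ^+ 2 * b - 192 * a * c - 128 * b ^+ 2) *: 'X^2
  + (2 * (9 * a ^+ 3 * b * c - 2 * a ^+ 2 * b ^+ 3 - 3 * a ^+ 2 * c ^+ 2
          - 40 * a * b ^+ 2 * c + 8 * b ^+ 4 + 72 * b * c ^+ 2)) *: 'X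
  + (- (4 * a ^+ 3 * c ^+ 3) + a ^+ 2 * b ^+ 2 * c ^+ 2 + 18 * a * b * c ^+ 3
     - 4 * b ^+ 3 * c ^+ 2 - 27 * c ^+ 4)%:P.

Lemma horner_Delta (R : comNzRingType) (a b c d z1 z2 z3 z4 : R) :
  quartic a b c d = \prod_(z <- [:: z1; z2; z3; z4]) ('X - z%:P) ->
  (Delta a b c).[d] =
    ((z1 - z2) * (z1 - z3) * (z1 - z4) * (z2 - z3) * (z2 - z4) * (z3 - z4)) ^+ 2.
Proof.
rewrite !big_cons big_nil => E.
have {}E : quartic a b c d =
  quartic (- (z1 + z2 + z3 + z4))
    (z1 * z2 + z1 * z3 + z1 * z4 + z2 * z3 + z2 * z4 + z3 * z4)
    (- (z1 * z2 * z3 + z1 * z2 * z4 + z1 * z3 * z4 + z2 * z3 * z4))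
    (z1 * z2 * z3 * z4).
  by rewrite E /quartic -!mul_polyC; ring.
have coefq (x y z t : R) : [/\ (quartic x y z t)`_3 = x,
    (quartic x y z t)`_2 = y, (quartic x y z t)`_1 = z
    & (quartic x y z t)`_0 = t].
  by rewrite /quartic; split;
    rewrite !(coefD, coefZ, coefXn, coefX, coefC) /= ?(mulr0, mulr1, add0r, addr0).
have := coefq a b c d; rewrite E.
have [-> -> -> ->] := coefq (- (z1 + z2 + z3 + z4))
    (z1 * z2 + z1 * z3 + z1 * z4 + z2 * z3 + z2 * z4 + z3 * z4)
    (- (z1 * z2 * z3 + z1 * z2 * z4 + z1 * z3 * z4 + z2 * z3 * z4))
    (z1 * z2 * z3 * z4).
by case=> <- <- <- <-; rewrite /Delta !(hornerD, hornerZ, hornerXn, hornerX, hornerC); ring.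
Qed.

Section RealRoots.
Variable R : realType.
Implicit Types (a b : R) (p : {poly R}) (s : seq R[i]).

Definition C0 a b : R := - (1 / 8 * a ^+ 3) + 1 / 2 * a * b.

(* Only meaningful for [0 <= 3 * a ^+ 2 - 8 * b]: [Num.sqrt] is [0] on
   negative arguments. *)
Definition C1 a b : R :=
  C0 a b + Num.sqrt 3 / 72 * Num.sqrt ((3 * a ^+ 2 - 8 * b) ^+ 3).

Definition C2 a b : R :=
  C0 a b - Num.sqrt 3 / 72 * Num.sqrt ((3 * a ^+ 2 - 8 * b) ^+ 3).

(* [s] lists the complex roots of [p] with multiplicity; for nonzero [p] this
   determines [s] up to permutation. *)
Definition has_roots p s : Prop :=
  map_poly (real_complex R) p =
    (lead_coef p)%:C *: \prod_(z <- s) ('X - z%:P).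

Definition nonreal (z : R[i]) : bool := complex.Im z != 0.

Definition no_real_roots p : Prop :=
  exists2 s : seq R[i], has_roots p s & all nonreal s.

Definition two_double_complex_roots p : Prop :=
  exists2 z : R[i], nonreal z & has_roots p [:: z; z; z^*; z^*].

Definition two_equal_real_roots p : Prop :=
  exists (r : R) (z : R[i]),
    nonreal z /\ has_roots p [:: r%:C; r%:C; z; z^*].

Definition two_distinct_real_roots p : Prop :=
  exists (r1 r2 : R) (z : R[i]),
    [/\ r1 < r2, nonreal z & has_roots p [:: r1%:C; r2%:C; z; z^*]].

Definition two_pairs_equal_real_roots p : Prop :=
  exists r1 r2 : R,
    r1 < r2 /\ has_roots p [:: r1%:C; r1%:C; r2%:C; r2%:C].

Definition four_distinct_real_roots p : Prop :=
  exists r1 r2 r3 r4 : R, [/\ r1 < r2, r2 < r3, r3 < r4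
    & has_roots p [:: r1%:C; r2%:C; r3%:C; r4%:C]].

Definition four_real_roots_extreme_two_equal p : Prop :=
  exists r1 r2 r3 : R, [/\ r1 < r2, r2 < r3
    & has_roots p [:: r1%:C; r1%:C; r2%:C; r3%:C] \/
      has_roots p [:: r1%:C; r2%:C; r3%:C; r3%:C]].

Definition four_real_roots_middle_two_equal p : Prop :=
  exists r1 r2 r3 : R, [/\ r1 < r2, r2 < r3
    & has_roots p [:: r1%:C; r2%:C; r2%:C; r3%:C]].

Definition four_real_roots_three_equal p : Prop :=
  exists r1 r2 : R, r1 != r2 /\
    has_roots p [:: r1%:C; r1%:C; r1%:C; r2%:C].

Definition four_equal_real_roots p (r : R) : Prop :=
  has_roots p [:: r%:C; r%:C; r%:C; r%:C].

Definition cubic_one_real_root p (r : R) : Prop :=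
  exists2 z : R[i], nonreal z & has_roots p [:: r%:C; z; z^*].

Definition cubic_triple_root p (r : R) : Prop :=
  has_roots p [:: r%:C; r%:C; r%:C].

Definition cubic_three_real_roots p (r1 r2 r3 : R) : Prop :=
  [/\ r1 > r2, r2 > r3 & has_roots p [:: r1%:C; r2%:C; r3%:C]].

Definition cubic_double_simple_roots p (r t : R) : Prop :=
  r != t /\ has_roots p [:: r%:C; r%:C; t%:C].

End RealRoots.

(* Main.v *)
Require Import Defs.
From HB Require Import structures.
From mathcomp Require Import all_boot all_order all_algebra.
From mathcomp Require Import complex reals ring lra.

Set Implicit Arguments.
Unset Strict Implicit.
Unset Printing Implicit Defensive.

Import Order.TTheory GRing.Theory Num.Theory.
Local Open Scope ring_scope.

(** Put [a = - 4 s] and [y = x - s], so that the quartic becomes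
    [y^4 + p y^2 + q y + r], where [p = b - 3/8 a^2], [q = c - C0 a b] and [r]
    differs from [d] by a constant.  The critical points in [y] do not depend
    on [d] and add up to [0]; call them [- 2 m] and [m +- sqrt (- e)].  Then
    [p = 2 e - 6 m^2] and [q = 8 m (m^2 + e)], and one can always take for
    [- 2 m] a root with [m^2 + e >= 0] (lemma [crit_params]: the intermediate
    value theorem gives one of sign opposite to [q] when [q] is not [0]).  It is a
    global minimum, because the quartic is
      [(y + 2 m)^2 ((y - 2 m)^2 + 2 (m^2 + e)) + (d - top_level)].
    The roots of the discriminant [Delta] are the values of [d] at which one
    of the critical points becomes a root of the quartic:
      [Delta = 256 (D - top_level) ((D - mid_level)^2 + 64 m^2 e^3)].

    This settles every case:
    - for [d > top_level] the quartic is positive ([above_top_no_roots]);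
    - when [d] is the level of a real critical point the quartic is
      [(x - r)^2 ((x - t)^2 - k)], and its root pattern is read off by comparing
      [k] with [0] and [(r - t)^2] (the lemmas on [double_form]);
    - for [d < top_level] the quartic takes a negative value, hence it has two
      distinct real roots and is their product with a quadratic.  The
      discriminant of the quartic is that of the quadratic times a square, so
      [Delta < 0] gives exactly two real roots
      ([negative_disc_two_roots]) and [Delta > 0] gives four
      ([positive_disc_four_roots]).

    The hypotheses on [c] become conditions on [e]: if [K] is the half-width
    of the interval from [C2] to [C1], then
    [K^2 - q^2 = 64/27 (- e) (e + 9 m^2)^2] ([sqr_C_radius]).  Thus, for
    [b < 3/8 a^2], [c] lies inside, at an end, or outside of the interval when [e < 0], [e = 0] or
    [e > 0], and [c = C0] means [m = 0] or [e = - m^2]. *)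

(** * Root lists *)

(** The scalar need not be known in advance to be the leading coefficient: a
    product of factors [X - z] is monic. *)
Lemma has_roots_scale (R : realType) (p : {poly R}) (k : R) (s : seq R[i]) :
  map_poly (real_complex R) p =
    real_complex R k *: \prod_(z <- s) ('X - z%:P) -> has_roots p s.
Proof.
move=> E; rewrite /has_roots E; congr (_ *: _).
rewrite -(lead_coef_map (real_complex R)) E lead_coefZ.
by rewrite (monicP (monic_prod_XsubC _ _ _)) mulr1.
Qed.

Lemma has_roots_real (R : realType) (p : {poly R}) (k : R) (s : seq R) :
  p = k *: \prod_(x <- s) ('X - x%:P) -> has_roots p (map (real_complex R) s).
Proof.
move=> ->; apply: (@has_roots_scale _ _ k).
rewrite map_polyZ rmorph_prod big_map; congr (_ *: _).
by apply: eq_bigr => x _; rewrite rmorphB /= map_polyX map_polyC.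
Qed.

Lemma map_quadratic (R : realType) (t j : R) :
  map_poly (real_complex R) (('X - t%:P) ^+ 2 + (j ^+ 2)%:P) =
  ('X - (t +i* j)%C%:P) * ('X - (t -i* j)%C%:P).
Proof.
rewrite rmorphD rmorphXn rmorphB /= map_polyX !map_polyC /=.
have -> : (t -i* j)%C = real_complex R t - 'i%C * real_complex R j.
  by rewrite /real_complex_def; simpc.
have -> : (t +i* j)%C = real_complex R t + 'i%C * real_complex R j.
  by rewrite /real_complex_def; simpc.
have i2 : 'i%C ^+ 2 = -1 :> R[i] by rewrite sqr_i.
have -> : real_complex R (j ^+ 2) = - ('i%C ^+ 2 * (real_complex R j) ^+ 2).
  by rewrite i2 rmorphXn mulN1r opprK.
by ring.
Qed.

(** A real quadratic without real roots, written in completed-square form,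
    contributes a pair of conjugate non-real roots. *)
Lemma has_roots_pair (R : realType) (p : {poly R}) (k t l : R) (s : seq R) :
  0 < l ->
  p = k *: (\prod_(x <- s) ('X - x%:P) * (('X - t%:P) ^+ 2 + l%:P)) ->
  exists2 z : R[i], nonreal z
    & has_roots p (map (real_complex R) s ++ [:: z; (z^*)%C]).
Proof.
move=> l0 ->; exists (t +i* Num.sqrt l)%C.
  by rewrite /nonreal /= gt_eqF // sqrtr_gt0.
apply: (@has_roots_scale _ _ k); rewrite map_polyZ rmorphM /=.
rewrite -{1}(sqr_sqrtr (ltW l0)) map_quadratic big_cat big_map; congr (_ *: (_ * _)).
  by rewrite rmorph_prod; apply: eq_bigr => x _; rewrite rmorphB /= map_polyX map_polyC.
by rewrite !big_cons big_nil /= mulr1.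
Qed.

(** The complex numbers are algebraically closed, so the polynomial splits, and
    a root with zero imaginary part would be a real root. *)
Lemma no_real_rootsP (R : realType) (p : {poly R}) :
  (forall x, p.[x] != 0) -> no_real_roots p.
Proof.
move=> p0.
have [s Es] := closed_field_poly_normal (map_poly (real_complex R) p).
exists s.
  by apply: (@has_roots_scale _ _ (lead_coef p)); rewrite {1}Es lead_coef_map.
apply/allP => z zs; apply/negP => /eqP z0.
have Ez : z = real_complex R (complex.Re z) by case: z z0 {zs} => x y /= ->.
have : (map_poly (real_complex R) p).[z] = 0.
  by rewrite Es hornerZ (rootP _) ?mulr0 // root_prod_XsubC.
rewrite Ez horner_map /= => /eqP; rewrite fmorph_eq0 => /eqP E.
by have := p0 (complex.Re z); rewrite E eqxx.
Qed.

(** * Quartics with a double real root *)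

(** Besides the double root [r] there are the roots [t +- sqrt k]. *)
Definition double_form (R : nzRingType) (r t k : R) : {poly R} :=
  ('X - r%:P) ^+ 2 * (('X - t%:P) ^+ 2 - k%:P).

Lemma double_form_split (R : comNzRingType) (r t j : R) :
  double_form r t (j ^+ 2) =
    ('X - r%:P) * (('X - r%:P) * (('X - (t - j)%:P) * ('X - (t + j)%:P))).
Proof. by rewrite /double_form; ring. Qed.

Lemma double_form_two_equal (R : realType) (r t k : R) :
  k < 0 -> two_equal_real_roots (double_form r t k).
Proof.
move=> k0; have k0' : 0 < - k by rewrite oppr_gt0.
have [|z nz h] := @has_roots_pair _ (double_form r t k) 1 t (- k) [:: r; r] k0'.
  by rewrite scale1r !big_cons big_nil /double_form polyCN; ring.
by exists r, z.
Qed.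

Lemma double_form_two_pairs (R : realType) (r t : R) :
  r != t -> two_pairs_equal_real_roots (double_form r t 0).
Proof.
rewrite neq_lt => /orP[] rt; [exists r, t | exists t, r]; split => //;
  [apply: (@has_roots_real _ _ 1 [:: r; r; t; t])
  |apply: (@has_roots_real _ _ 1 [:: t; t; r; r])];
  by rewrite scale1r !big_cons big_nil /double_form; ring.
Qed.

Lemma double_form_four_equal (R : realType) (r : R) :
  four_equal_real_roots (double_form r r 0) r.
Proof.
apply: (@has_roots_real _ _ 1 [:: r; r; r; r]).
by rewrite scale1r !big_cons big_nil /double_form; ring.
Qed.

(** The hypothesis says that [r] is outside the segment between the two other
    roots [t +- sqrt k]; whether it is below or above depends on the sign of
    [r - t]. *)
Lemma double_form_extreme (R : realType) (r t k : R) :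
  0 < k < (r - t) ^+ 2 -> four_real_roots_extreme_two_equal (double_form r t k).
Proof.
move=> /andP[k0]; rewrite -(sqr_sqrtr (ltW k0)).
have j0 : 0 < Num.sqrt k by rewrite sqrtr_gt0.
move: (Num.sqrt k) j0 => j j0 jrt; have [rt|rt] := leP r t.
  exists r, (t - j), (t + j); split; [nra|lra|left].
  apply: (@has_roots_real _ _ 1 [:: r; r; t - j; t + j]).
  by rewrite scale1r !big_cons big_nil double_form_split mulr1.
exists (t - j), (t + j), r; split; [lra|nra|right].
apply: (@has_roots_real _ _ 1 [:: t - j; t + j; r; r]).
by rewrite scale1r !big_cons big_nil double_form_split; ring.
Qed.

(** One of the roots [t +- (r - t)] is [r]; the other is its mirror image
    [2 t - r]. *)
Lemma double_form_three (R : realType) (r t : R) :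
  r != t -> four_real_roots_three_equal (double_form r t ((r - t) ^+ 2)).
Proof.
move=> rt; exists r, (t + t - r); split.
  by apply: contra rt => /eqP h; apply/eqP; lra.
apply: (@has_roots_real _ _ 1 [:: r; r; r; t + t - r]).
by rewrite scale1r !big_cons big_nil double_form_split; ring.
Qed.

(** The hypothesis says that [r] is strictly between [t - sqrt k] and
    [t + sqrt k]. *)
Lemma double_form_middle (R : realType) (r t k : R) :
  (r - t) ^+ 2 < k -> four_real_roots_middle_two_equal (double_form r t k).
Proof.
move=> kr; have k0 : 0 < k by apply: le_lt_trans kr; apply: sqr_ge0.
move: kr; rewrite -(sqr_sqrtr (ltW k0)).
have j0 : 0 < Num.sqrt k by rewrite sqrtr_gt0.
move: (Num.sqrt k) j0 => j j0 jrt.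
exists (t - j), r, (t + j); split; [nra|nra|].
apply: (@has_roots_real _ _ 1 [:: t - j; r; r; t + j]).
by rewrite scale1r !big_cons big_nil double_form_split; ring.
Qed.

(** * Quartics with a negative value *)

Lemma horner_quartic (R : comNzRingType) (a b c d x : R) :
  (quartic a b c d).[x] = x ^+ 4 + a * x ^+ 3 + b * x ^+ 2 + c * x + d.
Proof. by rewrite /quartic !(hornerD, hornerZ, hornerXn, hornerX, hornerC). Qed.

(** The quotient [x^2 + u x + v] by [(x - r1) (x - r2)] is determined by [a] and
    [b]; the remainder is linear and vanishes at the two points [r1] and [r2],
    so that it is zero, which gives [c] and [d]. *)
Lemma quartic_deflate (R : realType) (a b c d r1 r2 : R) :
  r1 != r2 -> root (quartic a b c d) r1 -> root (quartic a b c d) r2 ->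
  exists u v : R, [/\ a = u - (r1 + r2), b = v - u * (r1 + r2) + r1 * r2,
     c = u * r1 * r2 - v * (r1 + r2) & d = v * r1 * r2].
Proof.
move=> r12 /rootP; rewrite horner_quartic => e1 /rootP; rewrite horner_quartic => e2.
pose u := a + (r1 + r2); pose v := b + u * (r1 + r2) - r1 * r2.
have ec : c = u * r1 * r2 - v * (r1 + r2).
  apply/eqP; rewrite -subr_eq0 -(mulrI_eq0 _ (mulfI (x := r1 - r2) _)) ?subr_eq0 //.
  have -> : (r1 - r2) * (c - (u * r1 * r2 - v * (r1 + r2))) =
      (r1 ^+ 4 + a * r1 ^+ 3 + b * r1 ^+ 2 + c * r1 + d) -
      (r2 ^+ 4 + a * r2 ^+ 3 + b * r2 ^+ 2 + c * r2 + d) by rewrite /v /u; ring.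
  by rewrite e1 e2 subrr.
exists u, v; split=> //; try by rewrite /v /u; ring.
apply/eqP; rewrite -subr_eq0 -[X in _ == X]e1 [in X in _ == X]ec; apply/eqP.
by rewrite /v /u; ring.
Qed.

(** Squared differences of roots: those within the quadratic [x^2 + u x + v]
    give [u^2 - 4 v], those between [r1], [r2] and its roots give the values of
    the quadratic at [r1] and [r2]. *)
Lemma Delta_deflated (R : comNzRingType) (r1 r2 u v : R) :
  (Delta (u - (r1 + r2)) (v - u * (r1 + r2) + r1 * r2)
     (u * r1 * r2 - v * (r1 + r2))).[v * r1 * r2] =
  (u ^+ 2 - 4 * v) * ((r1 - r2) * (r1 ^+ 2 + u * r1 + v) * (r2 ^+ 2 + u * r2 + v)) ^+ 2.
Proof.
rewrite /Delta !(hornerD, hornerZ, hornerXn, hornerX, hornerC); ring.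
Qed.

(** The quartic is [e < 0] at [r] and nonnegative far away on both sides; the
    intermediate value theorem gives a root on each side of [r]. *)
Lemma quartic_negative_value (R : realType) (a b c d r t k e : R) :
  0 <= k -> e < 0 ->
  quartic a b c d = double_form r t (- k) + e%:P ->
  exists r1 r2 u v : R, r1 < r2 /\
    [/\ a = u - (r1 + r2), b = v - u * (r1 + r2) + r1 * r2,
     c = u * r1 * r2 - v * (r1 + r2) & d = v * r1 * r2].
Proof.
move=> k0 e0 E.
have val x : (quartic a b c d).[x] = (x - r) ^+ 2 * ((x - t) ^+ 2 + k) + e.
  by rewrite E /double_form !(hornerD, hornerM, hornerXn, hornerN, horner_exp, hornerX, hornerC) opprK.
have big x : 1 <= (x - r) ^+ 2 -> - e <= (x - t) ^+ 2 -> 0 <= (quartic a b c d).[x].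
  by rewrite val; nra.
have neg : (quartic a b c d).[r] = e by rewrite val; ring.
(* [M] is so large that at [r - M] and [r + M] both squares in the quartic are
   large enough to compensate for [e]. *)
pose M := 1 - e + `|r - t|.
have [r_t1 r_t2] : r - t <= `|r - t| /\ - (r - t) <= `|r - t|.
  by rewrite ler_norm -normrN ler_norm.
have [r2 /andP[le2 _] root2] : exists2 x, r <= x <= r + M & root (quartic a b c d) x.
  apply: poly_ivt; first by rewrite /M; nra.
  by rewrite neg (ltW e0) big // /M; nra.
have [r1 /andP[_ le1] root1] : exists2 x, r - M <= x <= r & root (- quartic a b c d) x.
  apply: poly_ivt; first by rewrite /M; nra.
  rewrite !hornerN neg oppr_ge0 (ltW e0) andbT oppr_le0 big // /M; nra.
rewrite rootN in root1.
have ner x : root (quartic a b c d) x -> x != r.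
  by move=> /rootP h; apply/eqP => xr; move: h; rewrite xr neg; lra.
have lt12 : r1 < r2.
  apply: (@lt_le_trans _ _ r) => //; rewrite lt_neqAle le1 andbT; exact: ner.
have [u [v h]] := quartic_deflate (negbT (lt_eqF lt12)) root1 root2.
by exists r1, r2, u, v.
Qed.

Lemma deflated_quarticE (R : comNzRingType) (r1 r2 u v : R) :
  quartic (u - (r1 + r2)) (v - u * (r1 + r2) + r1 * r2)
     (u * r1 * r2 - v * (r1 + r2)) (v * r1 * r2) =
  ('X - r1%:P) * (('X - r2%:P) * ('X^2 + u%:P * 'X + v%:P)).
Proof. by rewrite /quartic -!mul_polyC; ring. Qed.

Lemma negative_disc_two_roots (R : realType) (a b c d r t k e : R) :
  0 <= k -> e < 0 -> quartic a b c d = double_form r t (- k) + e%:P ->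
  (Delta a b c).[d] < 0 -> two_distinct_real_roots (quartic a b c d).
Proof.
move=> k0 e0 E.
have [r1 [r2 [u [v [r12 [-> -> -> ->]]]]]] := quartic_negative_value k0 e0 E.
rewrite Delta_deflated => D0.
have l0 : 0 < v - (u / 2) ^+ 2.
  rewrite ltNge; apply/negP => h.
  have h' : 0 <= u ^+ 2 - 4 * v by lra.
  have := mulr_ge0 h' (sqr_ge0
    ((r1 - r2) * (r1 ^+ 2 + u * r1 + v) * (r2 ^+ 2 + u * r2 + v))).
  by lra.
rewrite deflated_quarticE.
have [|z nz h] := @has_roots_pair R
  (('X - r1%:P) * (('X - r2%:P) * ('X^2 + u%:P * 'X + v%:P)))
  1 (- (u / 2)) _ [:: r1; r2] l0.
  have [h ->] : exists h, u = h + h by exists (u / 2); field.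
  have -> : (h + h) / 2 = h by field.
  by rewrite scale1r !big_cons big_nil; ring.
by exists r1, r2, z.
Qed.

(** Sorting spares the analysis of how the roots are interleaved. *)
Lemma four_distinct_real_rootsP (R : realType) (p : {poly R}) (s : seq R) :
  size s = 4 -> uniq s -> p = \prod_(x <- s) ('X - x%:P) ->
  four_distinct_real_roots p.
Proof.
move=> s4 us Ep.
have ps : perm_eq (sort <=%O s) s by rewrite perm_sort.
have := lt_sorted_uniq_le (sort <=%O s); rewrite sort_uniq us sort_le_sorted /=.
have {}Ep : p = 1 *: \prod_(x <- sort <=%O s) ('X - x%:P).
  by rewrite scale1r (perm_big _ ps).
have := size_sort <=%O s; rewrite s4.
case: (sort <=%O s) Ep => [|r1 [|r2 [|r3 [|r4 []]]]] //= Ep _ /and4P[h1 h2 h3 _].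
by exists r1, r2, r3, r4; split=> //; apply: (has_roots_real Ep).
Qed.

Lemma positive_disc_four_roots (R : realType) (a b c d r t k e : R) :
  0 <= k -> e < 0 -> quartic a b c d = double_form r t (- k) + e%:P ->
  0 < (Delta a b c).[d] -> four_distinct_real_roots (quartic a b c d).
Proof.
move=> k0 e0 E.
have [r1 [r2 [u [v [r12 [-> -> -> ->]]]]]] := quartic_negative_value k0 e0 E.
rewrite Delta_deflated => D0.
have l0 : 0 < u ^+ 2 - 4 * v.
  rewrite ltNge; apply/negP => h.
  have := mulr_le0_ge0 h (sqr_ge0
    ((r1 - r2) * (r1 ^+ 2 + u * r1 + v) * (r2 ^+ 2 + u * r2 + v))).
  by lra.
have : (r1 - r2) * (r1 ^+ 2 + u * r1 + v) * (r2 ^+ 2 + u * r2 + v) != 0.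
  by apply/eqP => h; move: D0; rewrite h; lra.
rewrite !mulf_eq0 !negb_or => /andP[/andP[_ q1] q2].
rewrite deflated_quarticE.
pose j := Num.sqrt (u ^+ 2 - 4 * v).
have j2 : j ^+ 2 = u ^+ 2 - 4 * v by rewrite sqr_sqrtr // ltW.
have j0 : 0 < j by rewrite sqrtr_gt0.
pose x1 := (- u - j) / 2; pose x2 := (- u + j) / 2.
have Eu : u = - (x1 + x2) by rewrite /x1 /x2; field.
have Ev : v = x1 * x2.
  have -> : x1 * x2 = (u ^+ 2 - j ^+ 2) / 4 by rewrite /x1 /x2; field.
  by rewrite j2; field.
have x12 : x1 < x2 by rewrite /x1 /x2; lra.
apply: (@four_distinct_real_rootsP _ _ [:: r1; r2; x1; x2]) => //; last first.
  by rewrite !big_cons big_nil Eu Ev; ring.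
rewrite /= !inE !negb_or (lt_eqF r12) (lt_eqF x12) /= andbT -!andbA.
apply/and4P; split.
- by apply: contra q1 => /eqP ->; apply/eqP; rewrite Ev Eu; ring.
- by apply: contra q1 => /eqP ->; apply/eqP; rewrite Ev Eu; ring.
- by apply: contra q2 => /eqP ->; apply/eqP; rewrite Ev Eu; ring.
- by apply: contra q2 => /eqP ->; apply/eqP; rewrite Ev Eu; ring.
Qed.

(** * Parametrization by the critical points *)

(** With [crit_c], the coefficients [b] and [c] of the quartic with [a = - 4 s]
    whose critical points are [s - 2 m] and the (possibly complex) points
    [s + m +- sqrt (- e)]. *)
Definition crit_b (R : pzRingType) (s m e : R) : R :=
  2 * e - 6 * m ^+ 2 + 6 * s ^+ 2.

Definition crit_c (R : pzRingType) (s m e : R) : R :=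
  8 * m * (m ^+ 2 + e) - 2 * (2 * e - 6 * m ^+ 2) * s - 4 * s ^+ 3.

Definition crit_quartic (R : comNzRingType) (s m e d : R) : {poly R} :=
  quartic (- (4 * s)) (crit_b s m e) (crit_c s m e) d.

Definition crit_Delta (R : comNzRingType) (s m e : R) : {poly R} :=
  Delta (- (4 * s)) (crit_b s m e) (crit_c s m e).

(** The constant coefficient [d] for which the critical point [s + h] is a root
    of the quartic.  The second line is the shift between [d] and the constant
    coefficient after the substitution [x = y + s]. *)
Definition level (R : pzRingType) (s m e h : R) : R :=
  h ^+ 2 * (3 * h ^+ 2 + (2 * e - 6 * m ^+ 2)) -
  (8 * m * (m ^+ 2 + e) * s - (2 * e - 6 * m ^+ 2) * s ^+ 2 - s ^+ 4).

Definition top_level (R : pzRingType) (s m e : R) : R := level s m e (- (2 * m)).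

(** The mean of the levels of the critical points [s + m +- sqrt (- e)].  These
    levels differ from it by [+- 8 m (sqrt (- e))^3], so that it is defined also
    when they are not real. *)
Definition mid_level (R : pzRingType) (s m e : R) : R :=
  e ^+ 2 - 10 * m ^+ 2 * e - 3 * m ^+ 4 -
  (8 * m * (m ^+ 2 + e) * s - (2 * e - 6 * m ^+ 2) * s ^+ 2 - s ^+ 4).

(** The hypothesis says that [s + h] is a critical point. *)
Lemma crit_quartic_double (R : comNzRingType) (s m e h d : R) :
  4 * h ^+ 3 + 2 * (2 * e - 6 * m ^+ 2) * h + 8 * m * (m ^+ 2 + e) = 0 ->
  crit_quartic s m e d =
    double_form (s + h) (s - h) (- (2 * h ^+ 2 + (2 * e - 6 * m ^+ 2))) +
    (d - level s m e h)%:P.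
Proof.
set p := 2 * e - 6 * m ^+ 2; set q := 8 * m * (m ^+ 2 + e) => E.
have {}E : q = - (4 * h ^+ 3 + 2 * p * h).
  by apply/eqP; rewrite -subr_eq0 opprK addrC E.
rewrite /crit_quartic /crit_b /crit_c /level -/p -/q E.
by rewrite /quartic /double_form -!mul_polyC; ring.
Qed.

(** The case [h = - 2 m]: the second factor is nonnegative as soon as
    [m^2 + e >= 0], so that [s - 2 m] is a global minimum. *)
Lemma crit_quartic_top (R : comNzRingType) (s m e d : R) :
  crit_quartic s m e d =
    double_form (s - 2 * m) (s + 2 * m) (- (2 * (m ^+ 2 + e))) +
    (d - top_level s m e)%:P.
Proof.
rewrite (@crit_quartic_double _ s m e (- (2 * m))); last by ring.
by congr (double_form _ _ _ + _); ring.
Qed.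

Lemma crit_DeltaE (R : comNzRingType) (s m e : R) :
  crit_Delta s m e = 256 *: (('X - (top_level s m e)%:P) *
    (('X - (mid_level s m e)%:P) ^+ 2 + (64 * m ^+ 2 * e ^+ 3)%:P)).
Proof.
rewrite /crit_Delta /Delta /crit_b /crit_c /top_level /level /mid_level -!mul_polyC.
by ring.
Qed.

Lemma horner_crit_Delta (R : comNzRingType) (s m e d : R) :
  (crit_Delta s m e).[d] = 256 * ((d - top_level s m e) *
    ((d - mid_level s m e) ^+ 2 + 64 * m ^+ 2 * e ^+ 3)).
Proof.
by rewrite crit_DeltaE !(hornerZ, hornerM, hornerD, hornerN, hornerX, hornerC, horner_exp).
Qed.

Lemma above_top_no_roots (R : realType) (s m e d : R) :
  0 <= m ^+ 2 + e -> top_level s m e < d -> no_real_roots (crit_quartic s m e d).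
Proof.
move=> me dt; apply: no_real_rootsP => x; apply: lt0r_neq0.
rewrite crit_quartic_top /double_form.
rewrite !(hornerM, hornerD, hornerN, hornerX, hornerC, horner_exp) opprK.
apply: ltr_wpDl; last by rewrite subr_gt0.
by rewrite mulr_ge0 ?sqr_ge0 // addr_ge0 ?sqr_ge0 // mulr_ge0.
Qed.

Lemma at_top_two_equal (R : realType) (s m e : R) :
  0 < m ^+ 2 + e -> two_equal_real_roots (crit_quartic s m e (top_level s m e)).
Proof.
move=> me; rewrite crit_quartic_top subrr polyC0 addr0.
by apply: double_form_two_equal; lra.
Qed.

Lemma below_top_two_roots (R : realType) (s m e d : R) :
  0 <= m ^+ 2 + e -> d < top_level s m e ->
  0 < (d - mid_level s m e) ^+ 2 + 64 * m ^+ 2 * e ^+ 3 ->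
  two_distinct_real_roots (crit_quartic s m e d).
Proof.
move=> me dt D0; apply: (negative_disc_two_roots _ _ (crit_quartic_top s m e d)).
- by rewrite mulr_ge0.
- by rewrite subr_lt0.
- rewrite -/(crit_Delta s m e) horner_crit_Delta pmulr_rlt0 //.
  by rewrite pmulr_llt0 // subr_lt0.
Qed.

Lemma below_top_four_roots (R : realType) (s m e d : R) :
  0 <= m ^+ 2 + e -> d < top_level s m e ->
  (d - mid_level s m e) ^+ 2 + 64 * m ^+ 2 * e ^+ 3 < 0 ->
  four_distinct_real_roots (crit_quartic s m e d).
Proof.
move=> me dt D0; apply: (positive_disc_four_roots _ _ (crit_quartic_top s m e d)).
- by rewrite mulr_ge0.
- by rewrite subr_lt0.
- rewrite -/(crit_Delta s m e) horner_crit_Delta pmulr_rgt0 //.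
  by rewrite nmulr_rgt0 // subr_lt0.
Qed.

(** * The cases *)

Lemma one_critical_point (R : realType) (s m e : R) :
  m != 0 -> 0 < e ->
  exists d0 : R, cubic_one_real_root (crit_Delta s m e) d0 /\
  forall d : R,
    (d0 < d -> no_real_roots (crit_quartic s m e d)) /\
    (d = d0 -> two_equal_real_roots (crit_quartic s m e d)) /\
    (d < d0 -> two_distinct_real_roots (crit_quartic s m e d)).
Proof.
move=> m0 e0; have me : 0 < m ^+ 2 + e by rewrite ltr_wpDl ?sqr_ge0.
have l0 : 0 < 64 * m ^+ 2 * e ^+ 3.
  by rewrite mulr_gt0 ?exprn_gt0 // mulr_gt0 // exprn_even_gt0.
exists (top_level s m e); split.
  have [|z nz h] := @has_roots_pair R (crit_Delta s m e) 256 (mid_level s m e) _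
    [:: top_level s m e] l0.
    by rewrite crit_DeltaE big_cons big_nil mulr1.
  by exists z.
move=> d; split; last split.
- exact: above_top_no_roots (ltW me).
- by move=> ->; apply: at_top_two_equal.
- by move=> h; apply: (below_top_two_roots (ltW me) h _); rewrite ltr_wpDl ?sqr_ge0.
Qed.

(** The quartic is biquadratic in [y = x - s], equal to [y^4 + 2 e y^2] up to a
    constant.  The levels of the two conjugate critical points coincide, at the
    value where the quartic is the square [(y^2 + e)^2]. *)
Lemma convex_biquadratic (R : realType) (s e : R) :
  0 < e ->
  exists dd dt : R, cubic_double_simple_roots (crit_Delta s 0 e) dd dt /\
  forall d : R,
    (dt < d -> no_real_roots (crit_quartic s 0 e d) /\
      (d = dd -> two_double_complex_roots (crit_quartic s 0 e d))) /\
    (d = dt -> two_equal_real_roots (crit_quartic s 0 e d)) /\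
    (d < dt -> two_distinct_real_roots (crit_quartic s 0 e d)).
Proof.
move=> e0; have me : 0 < 0 ^+ 2 + e by rewrite expr0n add0r.
have lev : mid_level s 0 e - top_level s 0 e = e ^+ 2.
  by rewrite /mid_level /top_level /level; ring.
have lt_tm : top_level s 0 e < mid_level s 0 e.
  by rewrite -subr_gt0 lev exprn_gt0.
exists (mid_level s 0 e), (top_level s 0 e); split.
  split; first by rewrite gt_eqF.
  apply: (@has_roots_real _ _ 256 [:: mid_level s 0 e; mid_level s 0 e; top_level s 0 e]).
  by rewrite crit_DeltaE !big_cons big_nil; congr (_ *: _); ring.
move=> d; split; last split.
- move=> dt; split; first exact: above_top_no_roots (ltW me) dt.
  move=> ->; exists (s +i* Num.sqrt e)%C; first by rewrite /nonreal /= gt_eqF // sqrtr_gt0.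
  apply: (@has_roots_scale _ _ 1); rewrite scale1r !big_cons big_nil /= mulr1.
  have -> : crit_quartic s 0 e (mid_level s 0 e) = (('X - s%:P) ^+ 2 + e%:P) ^+ 2.
    by rewrite /crit_quartic /quartic /crit_b /crit_c /mid_level -!mul_polyC; ring.
  by rewrite -{1}(sqr_sqrtr (ltW e0)) rmorphXn /= map_quadratic; ring.
- by move=> ->; apply: at_top_two_equal.
- move=> h; apply: (below_top_two_roots (ltW me) h _).
  rewrite expr0n mulr0 mul0r addr0 exprn_even_gt0 //= subr_eq0 lt_eqF //.
  exact: lt_trans h lt_tm.
Qed.

(** The quartic is [(x - s)^4] up to a constant. *)
Lemma quadruple_critical_point (R : realType) (s : R) :
  exists d0 : R, cubic_triple_root (crit_Delta s 0 0) d0 /\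
  d0 = s ^+ 4 /\
  forall d : R,
    (d0 < d -> no_real_roots (crit_quartic s 0 0 d)) /\
    (d = d0 -> four_equal_real_roots (crit_quartic s 0 0 d) s) /\
    (d < d0 -> two_distinct_real_roots (crit_quartic s 0 0 d)).
Proof.
have me : 0 <= 0 ^+ 2 + 0 :> R by rewrite expr0n add0r.
have tE : top_level s 0 0 = s ^+ 4 by rewrite /top_level /level; ring.
have mE : mid_level s 0 0 = s ^+ 4 by rewrite /mid_level; ring.
exists (s ^+ 4); split.
  apply: (@has_roots_real _ _ 256 [:: s ^+ 4; s ^+ 4; s ^+ 4]).
  by rewrite crit_DeltaE tE mE !big_cons big_nil; congr (_ *: _); ring.
split=> // d; split; last split.
- by move=> h; apply: (above_top_no_roots me _); rewrite tE.
- move=> ->; rewrite crit_quartic_top tE subrr addr0.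
  have -> : double_form (s - 2 * 0) (s + 2 * 0) (- (2 * (0 ^+ 2 + 0))) = double_form s s 0.
    by congr double_form; ring.
  exact: double_form_four_equal.
- move=> h; apply: (below_top_two_roots me _ _); first by rewrite tE.
  by rewrite mE expr0n mulr0 mul0r addr0 exprn_even_gt0 //= subr_eq0 lt_eqF.
Qed.

(** The value of [e] for which the critical points other than [- 2 m] are
    [m (1 + t)] and [m (1 - t)].  When [0 < t <= 1] and [m] is not [0], the second
    one is a local maximum, strictly between two local minima. *)
Definition inner_e (R : pzRingType) (m t : R) : R := - (t * m) ^+ 2.

(** The level of [s + m (1 - t)], the local maximum when [0 < t <= 1]. *)
Definition low_level (R : pzRingType) (s m t : R) : R :=
  mid_level s m (inner_e m t) - 8 * t ^+ 3 * m ^+ 4.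

(** The level of [s + m (1 + t)], the second local minimum when [0 < t <= 1]. *)
Definition high_level (R : pzRingType) (s m t : R) : R :=
  mid_level s m (inner_e m t) + 8 * t ^+ 3 * m ^+ 4.

Lemma crit_Delta_split (R : comNzRingType) (s m t : R) :
  crit_Delta s m (inner_e m t) =
    256 *: (('X - (top_level s m (inner_e m t))%:P) *
      (('X - (high_level s m t)%:P) * ('X - (low_level s m t)%:P))).
Proof.
rewrite crit_DeltaE /high_level /low_level; congr (_ *: (_ * _)).
by rewrite /inner_e; ring.
Qed.

Lemma inner_factor (R : comNzRingType) (s m t d : R) :
  (d - mid_level s m (inner_e m t)) ^+ 2 + 64 * m ^+ 2 * inner_e m t ^+ 3 =
  (d - high_level s m t) * (d - low_level s m t).
Proof. by rewrite /high_level /low_level /inner_e; ring. Qed.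

Lemma high_low_gap (R : comNzRingType) (s m t : R) :
  high_level s m t - low_level s m t = 16 * t ^+ 3 * m ^+ 4.
Proof. by rewrite /high_level /low_level; ring. Qed.

(** For [0 < t <= 1] this orders the three levels, with [high_low_gap]; the two upper
    ones coincide when [t = 1], that is, when both minima are equally deep. *)
Lemma top_high_gap (R : comNzRingType) (s m t : R) :
  top_level s m (inner_e m t) - high_level s m t = (3 + t) ^+ 3 * (1 - t) * m ^+ 4.
Proof. by rewrite /high_level /top_level /level /mid_level /inner_e; ring. Qed.

Lemma at_high_level (R : comNzRingType) (s m t : R) :
  crit_quartic s m (inner_e m t) (high_level s m t) =
    double_form (s + m * (1 + t)) (s - m * (1 + t)) (4 * m ^+ 2 * (1 - t)).
Proof.
rewrite (@crit_quartic_double _ _ _ _ (m * (1 + t))); last by rewrite /inner_e; ring.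
rewrite [X in X%:P](_ : _ = 0) ?addr0; first by congr double_form; rewrite /inner_e; ring.
by rewrite /level /high_level /mid_level /inner_e; ring.
Qed.

Lemma at_low_level (R : comNzRingType) (s m t : R) :
  crit_quartic s m (inner_e m t) (low_level s m t) =
    double_form (s + m * (1 - t)) (s - m * (1 - t)) (4 * m ^+ 2 * (1 + t)).
Proof.
rewrite (@crit_quartic_double _ _ _ _ (m * (1 - t))); last by rewrite /inner_e; ring.
rewrite [X in X%:P](_ : _ = 0) ?addr0; first by congr double_form; rewrite /inner_e; ring.
by rewrite /level /low_level /mid_level /inner_e; ring.
Qed.

Lemma at_low_middle (R : realType) (s m t : R) :
  m != 0 -> 0 < t <= 1 ->
  four_real_roots_middle_two_equal (crit_quartic s m (inner_e m t) (low_level s m t)).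
Proof.
move=> m0 /andP[t0 t1]; rewrite at_low_level; apply: double_form_middle.
have m2 : 0 < m ^+ 2 by rewrite exprn_even_gt0.
have -> : (s + m * (1 - t) - (s - m * (1 - t))) ^+ 2 = 4 * m ^+ 2 * (1 - t) ^+ 2 by ring.
have : 0 <= t * (1 - t) by rewrite mulr_ge0 // ?subr_ge0 // ltW.
rewrite ltr_pM2l; last by rewrite pmulr_rgt0.
by rewrite expr2; lra.
Qed.

Lemma three_critical_points (R : realType) (s m t : R) :
  m != 0 -> 0 < t < 1 ->
  exists d1 d2 d3 : R, cubic_three_real_roots (crit_Delta s m (inner_e m t)) d1 d2 d3 /\
  forall d : R,
    (d1 < d -> no_real_roots (crit_quartic s m (inner_e m t) d)) /\
    (d = d1 -> two_equal_real_roots (crit_quartic s m (inner_e m t) d)) /\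
    (d2 < d < d1 -> two_distinct_real_roots (crit_quartic s m (inner_e m t) d)) /\
    (d = d2 -> four_real_roots_extreme_two_equal (crit_quartic s m (inner_e m t) d)) /\
    (d3 < d < d2 -> four_distinct_real_roots (crit_quartic s m (inner_e m t) d)) /\
    (d = d3 -> four_real_roots_middle_two_equal (crit_quartic s m (inner_e m t) d)) /\
    (d < d3 -> two_distinct_real_roots (crit_quartic s m (inner_e m t) d)).
Proof.
move=> m0 /andP[t0 t1].
have m2 : 0 < m ^+ 2 by rewrite exprn_even_gt0.
have m4 : 0 < m ^+ 4 by rewrite exprn_even_gt0.
have me : 0 < m ^+ 2 + inner_e m t.
  have -> : m ^+ 2 + inner_e m t = (1 - t) * (1 + t) * m ^+ 2 by rewrite /inner_e; ring.
  by rewrite pmulr_lgt0 // mulr_gt0 //; lra.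
have lt_hl : low_level s m t < high_level s m t.
  by rewrite -subr_gt0 high_low_gap pmulr_lgt0 // pmulr_rgt0 // exprn_gt0.
have lt_th : high_level s m t < top_level s m (inner_e m t).
  by rewrite -subr_gt0 top_high_gap pmulr_lgt0 // mulr_gt0 ?exprn_gt0 //; lra.
exists (top_level s m (inner_e m t)), (high_level s m t), (low_level s m t); split.
  split=> //; apply: (@has_roots_real _ _ 256
    [:: top_level s m (inner_e m t); high_level s m t; low_level s m t]).
  by rewrite crit_Delta_split !big_cons big_nil mulr1.
move=> d; do ![split].
- exact: above_top_no_roots (ltW me).
- by move=> ->; apply: at_top_two_equal.
- move=> /andP[h1 h2]; apply: (below_top_two_roots (ltW me) h2 _).
  by rewrite inner_factor mulr_gt0 ?subr_gt0 //; apply: lt_trans h1.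
- move=> ->; rewrite at_high_level; apply: double_form_extreme.
  have -> : (s + m * (1 + t) - (s - m * (1 + t))) ^+ 2 = 4 * m ^+ 2 * (1 + t) ^+ 2 by ring.
  rewrite ltr_pM2l; last by rewrite pmulr_rgt0.
  apply/andP; split; last by rewrite expr2; nra.
  by rewrite pmulr_rgt0 ?subr_gt0 // pmulr_rgt0.
- move=> /andP[h1 h2]; apply: (below_top_four_roots (ltW me) (lt_trans h2 lt_th) _).
  by rewrite inner_factor nmulr_rlt0 ?subr_gt0 ?subr_lt0.
- by move=> ->; apply: at_low_middle => //; rewrite t0 ltW.
- move=> h; apply: (below_top_two_roots (ltW me) _ _).
    by apply: lt_trans lt_th; apply: lt_trans lt_hl.
  by rewrite inner_factor nmulr_rgt0 ?subr_lt0 //; apply: lt_trans lt_hl.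
Qed.

(** Here [s + m] is a double critical point, at which the quartic is monotone. *)
Lemma triple_critical_point (R : realType) (s m : R) :
  m != 0 ->
  exists dd dt : R, cubic_double_simple_roots (crit_Delta s m 0) dd dt /\
  forall d : R,
    (dt < d -> no_real_roots (crit_quartic s m 0 d)) /\
    (d = dt -> two_equal_real_roots (crit_quartic s m 0 d)) /\
    (dd < d < dt -> two_distinct_real_roots (crit_quartic s m 0 d)) /\
    (d = dd -> four_real_roots_three_equal (crit_quartic s m 0 d)) /\
    (d < dd -> two_distinct_real_roots (crit_quartic s m 0 d)).
Proof.
move=> m0.
have me : 0 < m ^+ 2 + 0 by rewrite addr0 exprn_even_gt0.
have lt_tm : mid_level s m 0 < top_level s m 0.
  rewrite -subr_gt0 (_ : _ - _ = 27 * m ^+ 4); last first.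
    by rewrite /mid_level /top_level /level; ring.
  by rewrite mulr_gt0 // exprn_even_gt0.
have D0 d : d != mid_level s m 0 -> 0 < (d - mid_level s m 0) ^+ 2 + 64 * m ^+ 2 * 0 ^+ 3.
  by move=> h; rewrite expr0n mulr0 addr0 exprn_even_gt0 //= subr_eq0.
exists (mid_level s m 0), (top_level s m 0); split.
  split; first by rewrite lt_eqF.
  apply: (@has_roots_real _ _ 256 [:: mid_level s m 0; mid_level s m 0; top_level s m 0]).
  by rewrite crit_DeltaE !big_cons big_nil; congr (_ *: _); ring.
move=> d; do ![split].
- exact: above_top_no_roots (ltW me).
- by move=> ->; apply: at_top_two_equal.
- by move=> /andP[h1 h2]; apply: (below_top_two_roots (ltW me) h2 (D0 _ _)); rewrite gt_eqF.
- move=> ->; rewrite (@crit_quartic_double _ _ _ _ m); last by ring.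
  rewrite [X in X%:P](_ : _ = 0) ?addr0; last by rewrite /level /mid_level; ring.
  rewrite (_ : - (_ + _) = (s + m - (s - m)) ^+ 2); last by ring.
  by apply: double_form_three; apply: contra m0 => /eqP h; apply/eqP; lra.
- move=> h; apply: (below_top_two_roots (ltW me) (lt_trans h lt_tm) (D0 _ _)).
  by rewrite lt_eqF.
Qed.

(** The critical points are [s - 2 m], [s] and [s + 2 m], and the quartic is
    symmetric about [s]: this is the limiting case [t = 1] of three real
    critical points, where the two minima have the same level. *)
Lemma double_well_biquadratic (R : realType) (s m : R) :
  m != 0 ->
  exists dd dt : R, cubic_double_simple_roots (crit_Delta s m (- m ^+ 2)) dd dt /\
  forall d : R,
    (dd < d -> no_real_roots (crit_quartic s m (- m ^+ 2) d)) /\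
    (d = dd -> two_pairs_equal_real_roots (crit_quartic s m (- m ^+ 2) d)) /\
    (dt < d < dd -> four_distinct_real_roots (crit_quartic s m (- m ^+ 2) d)) /\
    (d = dt -> four_real_roots_middle_two_equal (crit_quartic s m (- m ^+ 2) d)) /\
    (d < dt -> two_distinct_real_roots (crit_quartic s m (- m ^+ 2) d)).
Proof.
move=> m0; have -> : - m ^+ 2 = inner_e m 1 by rewrite /inner_e mul1r.
have me : 0 <= m ^+ 2 + inner_e m 1 by rewrite /inner_e mul1r subrr.
have lt_hl : low_level s m 1 < high_level s m 1.
  by rewrite -subr_gt0 high_low_gap expr1n mulr1 pmulr_rgt0 // exprn_even_gt0.
have tE : top_level s m (inner_e m 1) = high_level s m 1.
  by apply/eqP; rewrite -subr_eq0 top_high_gap subrr mulr0 mul0r.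
exists (high_level s m 1), (low_level s m 1); split.
  split; first by rewrite gt_eqF.
  apply: (@has_roots_real _ _ 256 [:: high_level s m 1; high_level s m 1; low_level s m 1]).
  by rewrite crit_Delta_split tE !big_cons big_nil mulr1.
move=> d; do ![split].
- by rewrite -tE; apply: above_top_no_roots me.
- move=> ->; rewrite at_high_level subrr mulr0; apply: double_form_two_pairs.
  by apply: contra m0 => /eqP h; apply/eqP; lra.
- move=> /andP[h1 h2]; apply: (below_top_four_roots me _ _); first by rewrite tE.
  by rewrite inner_factor nmulr_rlt0 ?subr_gt0 ?subr_lt0.
- by move=> ->; apply: at_low_middle => //; rewrite ltr01 lexx.
- move=> h; have h' := lt_trans h lt_hl.
  apply: (below_top_two_roots me _ _); first by rewrite tE.
  by rewrite inner_factor nmulr_rgt0 ?subr_lt0.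
Qed.

(** * Reduction to the cases *)

(** The cubic is [<= 0] at [0] and nonnegative at [1 + |p| + q]. *)
Lemma cubic_root_pos (R : rcfType) (p q : R) :
  0 < q -> exists2 m, 0 < m & 32 * m ^+ 3 + 4 * p * m = q.
Proof.
move=> q0; pose f : {poly R} := 32 *: 'X^3 + (4 * p) *: 'X - q%:P.
have fE x : f.[x] = 32 * x ^+ 3 + 4 * p * x - q.
  by rewrite /f !(hornerD, hornerN, hornerZ, hornerXn, hornerX, hornerC).
pose M := 1 + `|p| + q.
have p1 : - p <= `|p| by rewrite -normrN ler_norm.
have p2 : 0 <= `|p| by [].
have M1 : 1 <= M by rewrite /M; lra.
have [m /andP[m0 _]] : exists2 x, 0 <= x <= M & root f x.
  apply: poly_ivt; first by lra.
  rewrite !fE; apply/andP; split; first by rewrite expr0n !mulr0 addr0 add0r; lra.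
  have h1 : M * (- p) <= M * M by apply: ler_wpM2l; rewrite /M; lra.
  have h2 : M * M <= M * M * M by rewrite ler_peMr //; nra.
  have h3 : M <= M * M by rewrite ler_peMr //; lra.
  have h4 : q <= M by rewrite /M; lra.
  by rewrite !exprS expr0 mulr1 mulrA; nra.
move=> /rootP; rewrite fE => /eqP; rewrite subr_eq0 => /eqP fm.
exists m => //; rewrite lt_neqAle m0 andbT; apply/eqP => m00.
by move: fm; rewrite -m00 expr0n !mulr0 addr0; lra.
Qed.

(** The first equation determines [e]; the second then becomes
    [32 m^3 + 4 p m = q], of which a root with the same sign as [q] makes
    [m^2 + e] nonnegative.  For [q = 0] one takes [m = 0] if [p >= 0], and the
    deepest point of a double well, [m^2 + e = 0], otherwise. *)
Lemma depressed_params (R : rcfType) (p q : R) :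
  exists m e : R, [/\ p = 2 * e - 6 * m ^+ 2, q = 8 * m * (m ^+ 2 + e)
    & 0 <= m ^+ 2 + e].
Proof.
have [q0|q0|q0] := ltgtP 0 q.
- have [m m0 E] := cubic_root_pos p q0.
  exists m, ((p + 6 * m ^+ 2) / 2); split; [by field|by rewrite -E; field|].
  have : 0 < 8 * m * (m ^+ 2 + (p + 6 * m ^+ 2) / 2).
    have -> : 8 * m * (m ^+ 2 + (p + 6 * m ^+ 2) / 2) = q by rewrite -E; field.
    by [].
  by rewrite pmulr_rgt0 ?mulr_gt0 // => /ltW.
- have q0' : 0 < - q by rewrite oppr_gt0.
  have [m m0 E] := cubic_root_pos p q0'.
  have {}E : q = - (32 * m ^+ 3 + 4 * p * m) by rewrite E opprK.
  exists (- m), ((p + 6 * m ^+ 2) / 2); split; [by field|by rewrite E; field|].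
  have : 0 < 8 * m * (m ^+ 2 + (p + 6 * m ^+ 2) / 2).
    have -> : 8 * m * (m ^+ 2 + (p + 6 * m ^+ 2) / 2) = - q by rewrite E; field.
    by [].
  by rewrite sqrrN pmulr_rgt0 ?mulr_gt0 // => /ltW.
- have [p0|p0] := leP 0 p.
    by exists 0, (p / 2); split; [field | rewrite -q0; ring | lra].
  exists (Num.sqrt (- p / 8)), (p / 8); rewrite sqr_sqrtr; last by lra.
  by split; [field | rewrite -q0; field | lra].
Qed.

Lemma crit_params (R : realType) (a b c : R) :
  exists s m e : R, [/\ a = - (4 * s), b = crit_b s m e, c = crit_c s m e
    & 0 <= m ^+ 2 + e].
Proof.
have [m [e [Ep Eq me]]] := depressed_params (b - 3 / 8 * a ^+ 2) (c - C0 a b).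
exists (- (a / 4)), m, e; split=> //; first by field.
  by rewrite /crit_b -Ep; field.
by rewrite /crit_c -Ep -Eq /C0; field.
Qed.

Lemma crit_C0 (R : realType) (s m e : R) :
  crit_c s m e - C0 (- (4 * s)) (crit_b s m e) = 8 * m * (m ^+ 2 + e).
Proof. by rewrite /crit_c /crit_b /C0; field. Qed.

(** Half the distance between [C2] and [C1]. *)
Definition C_radius (R : realType) (a b : R) : R :=
  Num.sqrt 3 / 72 * Num.sqrt ((3 * a ^+ 2 - 8 * b) ^+ 3).

Lemma C_radius_ge0 (R : realType) (a b : R) : 0 <= C_radius a b.
Proof. by rewrite mulr_ge0 ?sqrtr_ge0 // divr_ge0 ?sqrtr_ge0. Qed.

(** The left side is a positive multiple of the discriminant of the derivative
    of the quartic, and the last square is the squared product of the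
    differences between [- 2 m] and the two other critical points. *)
Lemma sqr_C_radius (R : realType) (s m e : R) :
  e <= 3 * m ^+ 2 ->
  C_radius (- (4 * s)) (crit_b s m e) ^+ 2 - (8 * m * (m ^+ 2 + e)) ^+ 2 =
    64 / 27 * (- e * (e + 9 * m ^+ 2) ^+ 2).
Proof.
move=> em; rewrite /C_radius.
have -> : 3 * (- (4 * s)) ^+ 2 - 8 * crit_b s m e = 16 * (3 * m ^+ 2 - e).
  by rewrite /crit_b; ring.
rewrite exprMn expr_div_n !sqr_sqrtr //; last by rewrite exprn_ge0 // mulr_ge0 //; lra.
by field.
Qed.

Lemma inner_param (R : rcfType) (m e : R) :
  m != 0 -> e < 0 -> 0 < m ^+ 2 + e ->
  exists2 t : R, 0 < t < 1 & e = inner_e m t.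
Proof.
move=> m0 e0 me; have m2 : 0 < m ^+ 2 by rewrite exprn_even_gt0.
have u0 : 0 < - e / m ^+ 2 by rewrite divr_gt0 // oppr_gt0.
have u1 : - e / m ^+ 2 < 1 by rewrite ltr_pdivrMr // mul1r; lra.
exists (Num.sqrt (- e / m ^+ 2)).
  by rewrite sqrtr_gt0 u0 -[ltRHS]sqrtr1 ltr_sqrt.
by rewrite /inner_e exprMn sqr_sqrtr ?(ltW u0) // divfK ?opprK // gt_eqF.
Qed.

Theorem mainTheorem1 (R : realType) (a b c : R) :
  (3 / 8 * a ^+ 2 < b ->
    (c != C0 a b ->
      exists d0 : R, cubic_one_real_root (Delta a b c) d0 /\
      forall d : R,
        (d0 < d -> no_real_roots (quartic a b c d)) /\
        (d = d0 -> two_equal_real_roots (quartic a b c d)) /\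
        (d < d0 -> two_distinct_real_roots (quartic a b c d))) /\
    (c = C0 a b ->
      exists dd dt : R, cubic_double_simple_roots (Delta a b c) dd dt /\
      forall d : R,
        (dt < d -> no_real_roots (quartic a b c d) /\
          (d = dd -> two_double_complex_roots (quartic a b c d))) /\
        (d = dt -> two_equal_real_roots (quartic a b c d)) /\
        (d < dt -> two_distinct_real_roots (quartic a b c d)))) /\
  (b = 3 / 8 * a ^+ 2 ->
    C0 a b = a ^+ 3 / 16 /\
    (c != C0 a b ->
      exists d0 : R, cubic_one_real_root (Delta a b c) d0 /\
      forall d : R,
        (d0 < d -> no_real_roots (quartic a b c d)) /\
        (d = d0 -> two_equal_real_roots (quartic a b c d)) /\
        (d < d0 -> two_distinct_real_roots (quartic a b c d))) /\
    (c = C0 a b ->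
      exists d0 : R, cubic_triple_root (Delta a b c) d0 /\
      d0 = a ^+ 4 / 256 /\
      forall d : R,
        (d0 < d -> no_real_roots (quartic a b c d)) /\
        (d = d0 -> four_equal_real_roots (quartic a b c d) (- (a / 4))) /\
        (d < d0 -> two_distinct_real_roots (quartic a b c d)))) /\
  (b < 3 / 8 * a ^+ 2 ->
    (C2 a b < c < C1 a b -> c != C0 a b ->
      exists d1 d2 d3 : R, cubic_three_real_roots (Delta a b c) d1 d2 d3 /\
      forall d : R,
        (d1 < d -> no_real_roots (quartic a b c d)) /\
        (d = d1 -> two_equal_real_roots (quartic a b c d)) /\
        (d2 < d < d1 -> two_distinct_real_roots (quartic a b c d)) /\
        (d = d2 -> four_real_roots_extreme_two_equal (quartic a b c d)) /\
        (d3 < d < d2 -> four_distinct_real_roots (quartic a b c d)) /\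
        (d = d3 -> four_real_roots_middle_two_equal (quartic a b c d)) /\
        (d < d3 -> two_distinct_real_roots (quartic a b c d))) /\
    (c = C1 a b \/ c = C2 a b ->
      exists dd dt : R, cubic_double_simple_roots (Delta a b c) dd dt /\
      forall d : R,
        (dt < d -> no_real_roots (quartic a b c d)) /\
        (d = dt -> two_equal_real_roots (quartic a b c d)) /\
        (dd < d < dt -> two_distinct_real_roots (quartic a b c d)) /\
        (d = dd -> four_real_roots_three_equal (quartic a b c d)) /\
        (d < dd -> two_distinct_real_roots (quartic a b c d))) /\
    (c = C0 a b ->
      exists dd dt : R, cubic_double_simple_roots (Delta a b c) dd dt /\
      forall d : R,
        (dd < d -> no_real_roots (quartic a b c d)) /\
        (d = dd -> two_pairs_equal_real_roots (quartic a b c d)) /\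
        (dt < d < dd -> four_distinct_real_roots (quartic a b c d)) /\
        (d = dt -> four_real_roots_middle_two_equal (quartic a b c d)) /\
        (d < dt -> two_distinct_real_roots (quartic a b c d))) /\
    (c \notin `[C2 a b, C1 a b] ->
      exists d0 : R, cubic_one_real_root (Delta a b c) d0 /\
      forall d : R,
        (d0 < d -> no_real_roots (quartic a b c d)) /\
        (d = d0 -> two_equal_real_roots (quartic a b c d)) /\
        (d < d0 -> two_distinct_real_roots (quartic a b c d)))).
Proof.
have [s [m [e [-> -> -> me]]]] := crit_params a b c.
set a' := - (4 * s); set b' := crit_b s m e; set c' := crit_c s m e.
have bE : b' - 3 / 8 * a' ^+ 2 = 2 * e - 6 * m ^+ 2.
  by rewrite /b' /a' /crit_b; field.
have cE : c' - C0 a' b' = 8 * m * (m ^+ 2 + e) by exact: crit_C0.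
have m2 := sqr_ge0 m.
have neC0 : c' != C0 a' b' -> m != 0.
  by rewrite -subr_eq0 cE; apply: contra => /eqP ->; rewrite mulr0 mul0r.
have eqC0 : c' = C0 a' b' -> m = 0 \/ e = - m ^+ 2.
  move/eqP; rewrite -subr_eq0 cE !mulf_eq0 pnatr_eq0 /= => /orP[/eqP|/eqP h].
    by left.
  by right; lra.
split; last split.
- move=> hb; have e0 : 0 < e by lra.
  split; first by move/neC0 => m0; exact: one_critical_point.
  case/eqC0 => [m0|]; last by lra.
  by rewrite /a' /b' /c' m0; exact: convex_biquadratic.
- move=> hb; split; first by rewrite hb /C0; field.
  split.
    move/neC0 => m0; apply: one_critical_point => //.
    by have : 0 < m ^+ 2 by [rewrite exprn_even_gt0]; lra.
  move=> hc; have m0 : m = 0.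
    have [//|em] := eqC0 hc.
    by apply/eqP; rewrite -sqrf_eq0; apply/eqP; lra.
  have e0 : e = 0 by move: bE; rewrite hb m0 expr0n mulr0; lra.
  have [d0 [h1 [h2 h3]]] := quadruple_critical_point s.
  exists d0; rewrite /a' /b' /c' m0 e0; split=> //; split; first by rewrite h2; field.
  by rewrite (_ : - (- (4 * s) / 4) = s); [exact: h3 | field].
- move=> hb; have em : e < 3 * m ^+ 2 by lra.
  have KE := @sqr_C_radius R s m e (ltW em).
  have K0 := @C_radius_ge0 R a' b'.
  have C1E : C1 a' b' = C0 a' b' + C_radius a' b' by [].
  have C2E : C2 a' b' = C0 a' b' - C_radius a' b' by [].
  rewrite C1E C2E; move: KE K0; rewrite -/a' -/b' -cE => KE K0.
  split; last split; last split.
  + move=> /andP[h1 h2] /[dup] hc /neC0 m0.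
    have h : 0 < - e * (e + 9 * m ^+ 2) ^+ 2 by nra.
    have e0 : e < 0.
      by rewrite ltNge; apply/negP => e0; move: h; rewrite ltNge mulr_le0_ge0 ?sqr_ge0 // oppr_le0.
    have me0 : 0 < m ^+ 2 + e.
      rewrite lt_neqAle me andbT eq_sym; apply: contra hc => /eqP z.
      by rewrite -subr_eq0 cE z mulr0.
    have [t t01 te] := inner_param m0 e0 me0.
    by rewrite /a' /b' /c' te; exact: three_critical_points.
  + move=> hc; have : - e * (e + 9 * m ^+ 2) ^+ 2 = 0.
      by case: hc => hc; move: KE; rewrite hc; lra.
    move/eqP; rewrite mulf_eq0 oppr_eq0 sqrf_eq0 => z.
    have e0 : e = 0 by case/orP: z => /eqP z; lra.
    have m0 : m != 0 by apply/eqP => m0; move: em; rewrite e0 m0 expr0n mulr0 ltxx.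
    by rewrite /a' /b' /c' e0; exact: triple_critical_point.
  + move=> hc; have [m0|em'] := eqC0 hc.
      by move: em me; rewrite m0 expr0n mulr0 add0r; lra.
    have m0 : m != 0 by apply/eqP => m0; move: em; rewrite em' m0 expr0n oppr0 mulr0 ltxx.
    by rewrite /a' /b' /c' em'; exact: double_well_biquadratic.
  + rewrite in_itv /= negb_and -!ltNge => hc.
    have h : 0 < e * (e + 9 * m ^+ 2) ^+ 2 by case/orP: hc => hc; nra.
    have e0 : 0 < e.
      by rewrite ltNge; apply/negP => e0; move: h; rewrite ltNge mulr_le0_ge0 ?sqr_ge0.
    have m0 : m != 0.
      by apply/eqP => m0; move: em; rewrite m0 expr0n mulr0; lra.
    exact: one_critical_point.
Qed.
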